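(* Let $(P_k)_{k=1}^n$ be a proper spherical $2$-design in $\mathbb C^d$, and let $\mathcal M$ be the measurement with POVM $\bigl(\frac dnP_k\bigr)_{k=1}^n$. Then for every pure state $\varphi=|\varphi\rangle\langle\varphi|$ on $\mathbb C^d$, $$\begin{aligned}\log n-S_2\bigl(\mathcal M(\varphi)\bigr)&\ge\log n-S\bigl(\mathcal M(\varphi)\bigr)\\&=D\bigl(\mathcal M(\varphi)\,\|\,\mathcal M(\mathbb 1/d)\bigr)\\&\ge\frac1{2\ln2}\bigl\|\mathcal M(\varphi-\mathbb 1/d)\bigr\|_1^2\\&\ge\frac1{4\ln2}\,\frac{d-1}{d(d+1)^2}\\&\ge\frac1{6\ln2}\,\frac1{(d+1)^2}.\end{aligned}$$
   Context: $\log$ is the logarithm to base $2$. A proper spherical $2$-design is a family of rank-one projectors $P_1,\dots,P_n$ on $\mathbb C^d$ with $\frac1n\sum_{k=1}^nP_k\otimes P_k=\frac1{d(d+1)}(\mathbb 1+F)$, where $F$ is the swap operator on $\mathbb C^d\otimes\mathbb C^d$. For a Hermitian operator $\xi$, $\mathcal M(\xi)$ denotes the vector with entries $\frac dn\operatorname{Tr}(\xi P_k)$, $k=1,\dots,n$ (for a state $\xi$ this is the distribution of measurement outcomes), and $\|\cdot\|_1$ of such a vector is its $\ell_1$-norm. For probability vectors, $S(p)=-\sum_kp_k\log p_k$ is the Shannon entropy, $S_2(p)=-\log\sum_kp_k^2$ the Rényi entropy of order $2$, and $D(p\|q)=\sum_kp_k\log\frac{p_k}{q_k}$ the relative entrop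y.
   Formalization: The last inequality is stated only for d ≥ 3, since it is equivalent to (d−1)/d ≥ 2/3 and fails for d = 1, 2; for d ≥ 2 it is proved instead that (1/(2 ln 2))‖M(φ−1/d)‖₁² ≥ (1/(6 ln 2))/(d+1)². *)

(* Defs.v *)
From HB Require Import structures.
From mathcomp Require Import all_boot all_order all_algebra.
From mathcomp Require Import sesquilinear spectral complex mxtens.
From mathcomp Require Import reals exp.

Set Implicit Arguments.
Unset Strict Implicit.
Unset Printing Implicit Defensive.

Import Order.TTheory GRing.Theory Num.Theory.
Local Open Scope ring_scope.
Local Open Scope sesquilinear_scope.

Section Operators.
Context {R : realType}.

Definition rank_one_projector (d : nat) (Q : 'M[R[i]]_d) : Prop :=
  [/\ Q \is hermsymmx, Q *m Q = Q & \rank Q = 1%N].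

(* The columns of 'M_(d * d) are indexed by pairs through [mxtens_unindex],
   the convention of [tensmx]; so F (u *t v) = v *t u. *)
Definition swapmx (d : nat) : 'M[R[i]]_(d * d) :=
  \matrix_(i, j) (((mxtens_unindex i).1 == (mxtens_unindex j).2)
               && ((mxtens_unindex i).2 == (mxtens_unindex j).1))%:R.

Definition proper_spherical_2design (d n : nat) (P : 'I_n -> 'M[R[i]]_d) : Prop :=
  (forall k, rank_one_projector (P k)) /\
  n%:R^-1 *: (\sum_(k < n) (P k *t P k))
    = (d%:R * (d%:R + 1))^-1 *: (1%:M + swapmx d).

Definition pure_state (d : nat) (phi : 'M[R[i]]_d) : Prop :=
  exists2 v : 'cV[R[i]]_d, v ^t* *m v = 1%:M & phi = v *m v ^t*.

(* The trace of a product of two Hermitian matrices is real, so [complex.Re]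
   only changes the type. *)
Definition outcome (d n : nat) (P : 'I_n -> 'M[R[i]]_d) (xi : 'M[R[i]]_d) : 'rV[R]_n :=
  \row_k (d%:R / n%:R * complex.Re (\tr (xi *m P k))).

Definition max_mixed (d : nat) : 'M[R[i]]_d := (d%:R^-1)%:M.

End Operators.

Section Entropies.
Context {R : realType}.

Definition log2 (x : R) : R := ln x / ln 2.

Definition l1norm (n : nat) (p : 'rV[R]_n) : R := \sum_k `|p 0 k|.

(* 0 log 0 = 0 holds since the factor p_k vanishes. *)
Definition shannon (n : nat) (p : 'rV[R]_n) : R := - \sum_k p 0 k * log2 (p 0 k).

Definition renyi2 (n : nat) (p : 'rV[R]_n) : R := - log2 (\sum_k p 0 k ^+ 2).

(* Real-valued, hence meaningful when q_k = 0 implies p_k = 0 (otherwise the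
   relative entropy is +oo). *)
Definition relative_entropy (n : nat) (p q : 'rV[R]_n) : R :=
  \sum_k p 0 k * log2 (p 0 k / q 0 k).

End Entropies.

(* Main.v *)
Require Import Defs.
From HB Require Import structures.
From mathcomp Require Import all_boot all_order all_algebra.
From mathcomp Require Import sesquilinear spectral complex mxtens.
From mathcomp Require Import reals exp.
From mathcomp Require Import classical_sets topology normedtype derive realfun ring lra.

Set Implicit Arguments.
Unset Strict Implicit.
Unset Printing Implicit Defensive.

Import Order.TTheory GRing.Theory Num.Theory.
Local Open Scope ring_scope.
Import numFieldNormedType.Exports.

(** The overlaps a_k = Tr (phi P_k) lie in [0, 1], and the design identity traced
    against [phi (x) 1] and [phi (x) phi] gives [\sum a_k = n / d] and
    [\sum a_k^2 = 2 n / (d (d + 1))].  For d >= 2 every deviation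
    [|a_k - 1/d|] is at most [(d - 1) / d], so the l1-norm dominates the variance
    divided by [(d - 1) / d]; this yields the l1-norm bound [1 / (d + 1)], which
    is stronger than what the last inequalities need.  Pinsker's inequality
    against the uniform distribution follows from
    [3 (x - 1)^2 <= (2 x + 4) (x ln x - x + 1)] and Cauchy-Schwarz. *)

(** * Logarithmic and entropic inequalities over the reals *)

Section RealInequalities.
Variable R : realType.
Implicit Types x y : R.

(* Equals [ln x - (x - 1) (5 x + 1) / (2 x (x + 2))], the gap of
   [pinsker_pointwise] divided by [2 x (x + 2)]; this division makes the
   derivative rational. *)
Definition log_gap x : R := ln x - 5 / 2 + 4^-1 * x^-1 + 27 / 4 * (x + 2)^-1.

Lemma is_derive_log_gap x : 0 < x ->
  is_derive x 1 log_gap ((x - 1) ^+ 3 / (x ^+ 2 * (x + 2) ^+ 2)).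
Proof.
move=> x0.
have xn : x != 0 by rewrite gt_eqF.
have x2n : x + 2 != 0 by rewrite gt_eqF// addr_gt0.
have lx := is_derive1_ln x0.
have Vx : is_derive x 1 (fun y : R => y^-1) (- x ^- 2 *: 1).
  exact: (@is_deriveV _ id).
have V2x : is_derive x 1 (fun y : R => (y + 2)^-1) (- (x + 2) ^- 2 *: (1 + 0)).
  exact: (@is_deriveV _ (fun y => y + 2)).
rewrite /log_gap; apply: is_derive_eq.
rewrite /GRing.scale /=; field; exact/andP.
Qed.

(** The derivative has the sign of [x - 1] and [log_gap 1 = 0], so the mean value theorem between
    [x] and [1] settles both sides. *)
Lemma log_gap_ge0 x : 0 < x -> 0 <= log_gap x.
Proof.
move=> x0.
have g1 : log_gap 1 = 0 by rewrite /log_gap ln1; field.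
have within a b : 0 < a -> {within `[a, b], continuous log_gap}%classic.
  move=> a0; apply: derivable_within_continuous => y; rewrite in_itv /= => /andP[ay _].
  by case: (is_derive_log_gap (lt_le_trans a0 ay)).
have mvt a b : 0 < a -> a < b -> exists2 c, a < c < b &
    log_gap b - log_gap a = (c - 1) ^+ 3 / (c ^+ 2 * (c + 2) ^+ 2) * (b - a).
  move=> a0 ab.
  have dg y : y \in `]a, b[ -> is_derive y 1 log_gap
      ((y - 1) ^+ 3 / (y ^+ 2 * (y + 2) ^+ 2)).
    by rewrite in_itv /= => /andP[/(lt_trans a0) y0 _]; exact: is_derive_log_gap.
  by have [c] := MVT ab dg (within a b a0); rewrite in_itv /=; exists c.
have [x1|x1|->] := ltgtP x 1; last by rewrite g1.
  have [c /andP[xc c1]] := mvt _ _ x0 x1; rewrite g1 sub0r => E.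
  have D0 : 0 <= (c ^+ 2 * (c + 2) ^+ 2)^-1 by rewrite invr_ge0 mulr_ge0 ?sqr_ge0.
  have c3 : 0 <= (1 - c) ^+ 3 by rewrite exprn_ge0 ?subr_ge0 ?ltW.
  have x1' : 0 <= 1 - x by rewrite subr_ge0 ltW.
  by have := mulr_ge0 (mulr_ge0 c3 D0) x1'; lra.
have [c /andP[c1 cx]] := mvt _ _ ltr01 x1; rewrite g1 subr0 => ->.
have D0 : 0 <= (c ^+ 2 * (c + 2) ^+ 2)^-1 by rewrite invr_ge0 mulr_ge0 ?sqr_ge0.
have c3 : 0 <= (c - 1) ^+ 3 by rewrite exprn_ge0 ?subr_ge0 ?ltW.
by apply: mulr_ge0 (mulr_ge0 c3 D0) _; rewrite subr_ge0 ltW.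
Qed.

(* The pointwise inequality behind Pinsker's inequality; at [x = 0] it reads
   [3 <= 4], the convention [0 ln 0 = 0] being built in. *)
Lemma pinsker_pointwise x : 0 <= x ->
  3 * (x - 1) ^+ 2 <= (2 * x + 4) * (x * ln x - x + 1).
Proof.
rewrite le_eqVlt => /orP[/eqP <-|x0]; first by rewrite !mul0r; lra.
have xn : x != 0 by rewrite gt_eqF.
have x2n : x + 2 != 0 by rewrite gt_eqF// addr_gt0.
rewrite -subr_ge0.
suff -> : (2 * x + 4) * (x * ln x - x + 1) - 3 * (x - 1) ^+ 2 =
  2 * x * (x + 2) * log_gap x.
  have := log_gap_ge0 x0.
  by apply: mulr_ge0; apply: mulr_ge0; lra.
by rewrite /log_gap; field; apply/andP.
Qed.

(** Square-root-free form: the pointwise product bound is the shape that [pinsker_pointwise]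
    supplies after division by 3. *)
Lemma cauchy_schwarz_sum (I : finType) (a u w : I -> R) :
  (forall k, 0 <= a k) -> (forall k, 0 <= u k) -> (forall k, 0 <= w k) ->
  (forall k, a k ^+ 2 <= u k * w k) ->
  (\sum_k a k) ^+ 2 <= (\sum_k u k) * (\sum_k w k).
Proof.
move=> a0 u0 w0 auw.
suff [] : [/\ 0 <= \sum_k a k, 0 <= \sum_k u k, 0 <= \sum_k w k &
  (\sum_k a k) ^+ 2 <= (\sum_k u k) * (\sum_k w k)] by [].
apply: (big_rec3 (fun W U A => [/\ 0 <= A, 0 <= U, 0 <= W & A ^+ 2 <= U * W])).
  by rewrite mulr0 expr0n.
move=> k W U A _ [A0 U0 W0 AUW]; split; try exact: addr_ge0.
(* AM-GM without roots: [(2 a A)^2 <= 4 (u W) (U w) <= (u W + U w)^2]. *)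
have cross : 2 * (a k * A) <= u k * W + U * w k.
  rewrite -ler_sqr ?nnegrE ?addr_ge0 ?mulr_ge0//.
  have : (a k * A) ^+ 2 <= u k * w k * (U * W).
    by rewrite exprMn ler_pM ?sqr_ge0.
  have := sqr_ge0 (u k * W - U * w k); lra.
have := auw k; lra.
Qed.

Lemma ln_le_subr1 x : 0 < x -> ln x <= x - 1.
Proof.
move=> x0; have := @le_ln1Dx R (x - 1).
by rewrite ltrBrDr addNr addrC subrK; apply.
Qed.

Lemma ln2_gt0 : 0 < ln 2 :> R.
Proof. by rewrite ln_gt0 ?ltr1n. Qed.

Section Distribution.
Variables (n : nat) (p : 'rV[R]_n).
Hypothesis p_ge0 : forall k, 0 <= p 0 k.
Hypothesis p_sum1 : \sum_k p 0 k = 1.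

Lemma distr_size_gt0 : (0 < n)%N.
Proof.
case: n p p_sum1 => // q /eqP.
by rewrite big_ord0 eq_sym oner_eq0.
Qed.

(** Jensen's inequality for the concave [ln] under the weights [p], obtained from the tangent bound
    [ln x <= x - 1] at [x = p_k / s]. *)
Lemma renyi2_le_shannon : renyi2 p <= shannon p.
Proof.
set s := \sum_k p 0 k ^+ 2.
have s0 : 0 < s.
  rewrite lt_def sumr_ge0 ?andbT; last by move=> k _; exact: sqr_ge0.
  apply/eqP => /eqP; rewrite psumr_eq0 => [/allP z|k _]; last exact: sqr_ge0.
  have /eqP := p_sum1; rewrite big1 ?(eq_sym 0) ?oner_eq0// => k _.
  by have := z k (mem_index_enum _); rewrite sqrf_eq0 => /eqP.
rewrite /renyi2 /shannon /log2 lerN2 -/s.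
under eq_bigr do rewrite mulrA.
rewrite -mulr_suml ler_pM2r ?invr_gt0 ?ln2_gt0//.
(* The added corrections sum to [s / s - 1 = 0], which allows a termwise comparison. *)
have -> : ln s = \sum_k (p 0 k * ln s + (p 0 k ^+ 2 / s - p 0 k)).
  rewrite big_split sumrB /= -!mulr_suml p_sum1 -/s divff ?gt_eqF//; ring.
apply: ler_sum => k _.
have := p_ge0 k; rewrite le_eqVlt => /orP[/eqP <-|pk0].
  by rewrite expr0n /= !mul0r subr0 addr0.
have := ln_le_subr1 (divr_gt0 pk0 s0); rewrite ln_div ?posrE// lerBlDl.
rewrite -(ler_pM2l pk0) => /le_trans; apply.
by rewrite mulrDr mulrBr mulr1 mulrA -expr2.
Qed.

Let q : 'rV[R]_n := const_mx n%:R^-1.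

Let n_gt0 : 0 < n%:R :> R.
Proof. by rewrite ltr0n distr_size_gt0. Qed.

Lemma relative_entropy_uniform : relative_entropy p q = log2 n%:R - shannon p.
Proof.
rewrite /relative_entropy /shannon opprK.
have -> : log2 n%:R = \sum_k p 0 k * log2 n%:R by rewrite -mulr_suml p_sum1 mul1r.
rewrite -big_split; apply: eq_bigr => k _; rewrite !mxE invrK /=.
have := p_ge0 k; rewrite le_eqVlt => /orP[/eqP <-|pk0]; first by rewrite !mul0r addr0.
by rewrite /log2 lnM ?posrE//; ring.
Qed.

Lemma pinsker_uniform :
  1 / (2 * ln 2) * l1norm (p - q) ^+ 2 <= relative_entropy p q.
Proof.
have nn : n%:R != 0 :> R by rewrite gt_eqF.
pose x k := n%:R * p 0 k.
have x0 k : 0 <= x k by rewrite mulr_ge0// ltW.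
have sumx : \sum_k x k = n%:R by rewrite -mulr_sumr p_sum1 mulr1.
(* The part [- x k + 1] sums to 0, so [h] has the same sum as [x ln x], yet each of its terms is
   nonnegative, as Cauchy-Schwarz requires. *)
pose h k := x k * ln (x k) - x k + 1.
have h0 k : 0 <= h k.
  rewrite -(@pmulr_rge0 _ (2 * x k + 4)); last by have := x0 k; lra.
  by apply: le_trans (pinsker_pointwise (x0 k)); rewrite mulr_ge0 ?sqr_ge0.
have relE : relative_entropy p q * ln 2 * n%:R = \sum_k h k.
  rewrite /h big_split sumrB /= sumx sumr_const card_ord subrK.
  rewrite /relative_entropy !mulr_suml; apply: eq_bigr => k _.
  rewrite /log2 mxE invrK (mulrC (p 0 k) n%:R) -/(x k).
  by rewrite mulrA divfK ?gt_eqF ?ln2_gt0// mulrC mulrA.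
have l1E : l1norm (p - q) * n%:R = \sum_k `|x k - 1|.
  rewrite /l1norm mulr_suml; apply: eq_bigr => k _; rewrite !mxE.
  rewrite -[X in _ * X]ger0_norm ?ltW// -normrM; congr `|_|.
  by rewrite /x; field.
have : (\sum_k `|x k - 1|) ^+ 2 <= (\sum_k (2 * x k + 4) / 3) * (\sum_k h k).
  apply: cauchy_schwarz_sum => // k; first by have := x0 k; lra.
  rewrite real_normK ?num_real//.
  by have := pinsker_pointwise (x0 k); rewrite /h; lra.
(* The weights [(2 x k + 4) / 3] sum to [(2 n + 4 n) / 3 = 2 n], the source of the constant
   [2 ln 2]. *)
rewrite -mulr_suml big_split /= -mulr_sumr sumx sumr_const card_ord -relE -l1E.
rewrite -[4 *+ n]mulr_natr => key.
have {}key : l1norm (p - q) ^+ 2 <= 2 * ln 2 * relative_entropy p q.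
  rewrite -(ler_pM2r (exprn_gt0 2 n_gt0)) -exprMn (le_trans key)//.
  by rewrite le_eqVlt; apply/orP; left; apply/eqP; field.
by rewrite mul1r ler_pdivrMl// mulr_gt0 ?ln2_gt0.
Qed.

End Distribution.
End RealInequalities.

(** * Traces of tensor products and of projectors *)

Section MatrixTraces.
Local Open Scope sesquilinear_scope.

Lemma mxtrace_tens (K : comPzRingType) (m p : nat) (A : 'M[K]_m) (B : 'M[K]_p) :
  \tr (A *t B) = \tr A * \tr B.
Proof.
rewrite /mxtrace big_distrlr pair_bigA /=.
rewrite (reindex (@mxtens_index m p)) /=; last first.
  by exists (@mxtens_unindex m p) => ? _; rewrite (mxtens_indexK, mxtens_unindexK).
by apply: eq_bigr => ij _; rewrite !mxE mxtens_indexK.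
Qed.

Lemma mxtrace_tens_swap (R : realType) (d : nat) (A B : 'M[R[i]]_d) :
  \tr ((A *t B) *m swapmx d) = \tr (A *m B).
Proof.
have bij : {on [pred _ | true], bijective (@mxtens_index d d)}.
  by exists (@mxtens_unindex d d) => ? _; rewrite (mxtens_indexK, mxtens_unindexK).
rewrite /mxtrace (reindex _ bij) /=.
under [RHS]eq_bigr do rewrite mxE.
rewrite pair_bigA /=; apply: eq_bigr => -[a b] _ /=.
(* In row [(a, b)] the swap picks out the single inner index [(b, a)]. *)
rewrite mxE (reindex _ bij) /= (bigD1 (b, a)) //= big1 ?addr0 => [|[x y] /= ne].
  by rewrite !mxE !mxtens_indexK /= !eqxx mulr1.
rewrite !mxE !mxtens_indexK /=.
case: eqP => [ay|]; case: eqP => [bx|]; rewrite ?mulr0 //.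
by rewrite ay bx eqxx in ne.
Qed.

(** In a full-rank factorization [Q = C R], idempotence reads [C (R C) R = C R]; cancelling [C] and
    [R] makes [R C] the identity of size [\rank Q]. *)
Lemma mxtrace_idempotent (F : fieldType) (d : nat) (Q : 'M[F]_d) :
  Q *m Q = Q -> \tr Q = (\rank Q)%:R.
Proof.
move=> QQ; suff RC : row_base Q *m col_base Q = 1%:M.
  by rewrite -{1}(mulmx_base Q) mxtrace_mulC RC mxtrace1.
apply: (row_free_inj (row_base_free Q)); apply: (row_full_inj (col_base_full Q)).
by rewrite mul1mx -mulmxA mulmxA !mulmx_base.
Qed.

Lemma mxtrace_gram_ge0 (C : numClosedFieldType) (m p : nat) (A : 'M[C]_(m, p)) :
  0 <= \tr (A *m A ^t*).
Proof.
apply: sumr_ge0 => i _; rewrite mxE; apply: sumr_ge0 => j _.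
by rewrite !mxE mul_conjC_ge0.
Qed.

(** By cyclicity and [Q = Q^2], the trace is that of the Gram matrix of [Q v]. *)
Lemma mxtrace_projector_ge0 (C : numClosedFieldType) (d : nat)
    (Q : 'M[C]_d) (v : 'cV[C]_d) :
  Q ^t* = Q -> Q *m Q = Q -> 0 <= \tr (v *m v ^t* *m Q).
Proof.
move=> Qh QQ; have := mxtrace_gram_ge0 (Q *m v).
by rewrite trmx_mul map_mxM Qh mulmxA mxtrace_mulC !mulmxA QQ -mulmxA mxtrace_mulC.
Qed.
End MatrixTraces.

(** * Moments of a spherical 2-design *)

Section Design.
Variable R : realType.
Local Notation C := R[i].
Local Open Scope complex_scope.
Local Open Scope sesquilinear_scope.

Lemma Re_natVM (m : nat) (z : C) : complex.Re (m%:R^-1 * z) = m%:R^-1 * complex.Re z.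
Proof.
have -> : m%:R^-1 = (m%:R^-1 : R)%:C by rewrite fmorphV rmorph_nat.
by case: z => a b /=; rewrite mul0r subr0.
Qed.

Variables (d n : nat) (P : 'I_n -> 'M[C]_d).
Hypothesis designP : proper_spherical_2design P.

Lemma projector_trace k : \tr (P k) = 1.
Proof. by have [/(_ k)[_ PP rk] _] := designP; rewrite mxtrace_idempotent// rk. Qed.

Lemma projector_hermitian k : (P k) ^t* = P k.
Proof.
by have [/(_ k)[/is_hermitianmxP]] := designP; rewrite expr0 scale1r.
Qed.

(** The design identity is traced against [A *t B]; the swap contributes [\tr (A *m B)]. Taking
    [B = 1] gives first moments, [B = A] second ones. *)
Lemma design_moments (A B : 'M[C]_d) :
  n%:R^-1 * \sum_k \tr (A *m P k) * \tr (B *m P k) =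
  (d%:R * (d%:R + 1))^-1 * (\tr A * \tr B + \tr (A *m B)).
Proof.
have [_ /(congr1 (fun M => \tr (A *t B *m M)))] := designP.
rewrite -!scalemxAr !mxtraceZ mulmxDr mulmx1 mxtraceD mxtrace_tens.
rewrite mxtrace_tens_swap mulmx_sumr raddf_sum /= => <-.
by congr (_ * _); apply: eq_bigr => k _; rewrite tensmx_mul mxtrace_tens.
Qed.

Lemma outcome_max_mixed : (0 < d)%N -> outcome P (max_mixed d) = const_mx n%:R^-1.
Proof.
move=> d0; apply/rowP => k; rewrite !mxE mul_scalar_mx mxtraceZ projector_trace.
by rewrite Re_natVM mulr1 mulrAC divff ?mul1r// pnatr_eq0 -lt0n.
Qed.

Lemma outcomeB (A B : 'M[C]_d) : outcome P (A - B) = outcome P A - outcome P B.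
Proof.
apply/rowP => k; rewrite !mxE -mulrBr mulmxBl raddfB /=.
by case: (\tr _) => ? ?; case: (\tr _) => ? ?.
Qed.

(** * Overlaps of a pure state with the design *)

Section Pure.
Variable phi : 'M[C]_d.
Hypothesis pure_phi : pure_state phi.

Lemma pure_dim_gt0 : (0 < d)%N.
Proof.
have [v vv _] := pure_phi; rewrite lt0n; apply/eqP => d0.
move: vv => /(congr1 mxtrace); rewrite mxtrace_mulC mxtrace1 /mxtrace big1 => [/eqP|i _].
  by rewrite eq_sym oner_eq0.
by have := ltn_ord i; rewrite [X in (_ < X)%N]d0.
Qed.

Lemma pure_trace : \tr phi = 1.
Proof. by have [v vv ->] := pure_phi; rewrite mxtrace_mulC vv mxtrace1. Qed.

Lemma pure_idempotent : phi *m phi = phi.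
Proof.
have [v vv ->] := pure_phi.
by rewrite mulmxA -(mulmxA v) vv mulmx1.
Qed.

Let a k := complex.Re (\tr (phi *m P k)).

(** Positivity is applied to the projector [P k] and to its complement [1 - P k]. *)
Lemma overlap_bounds k : 0 <= \tr (phi *m P k) <= 1.
Proof.
have [/(_ k)[_ PP _] _] := designP; have Ph := projector_hermitian k.
have [v vv phiE] := pure_phi; apply/andP; split.
  by rewrite phiE mxtrace_projector_ge0.
rewrite -subr_ge0 -pure_trace -{1}[phi]mulmx1 -raddfB -mulmxBr phiE /=.
apply: mxtrace_projector_ge0.
  by rewrite raddfB raddfB /= trmx1 map_mx1 Ph.
by rewrite mulmxBr mulmx1 mulmxBl mul1mx PP subrr subr0.
Qed.

Let a_real k : \tr (phi *m P k) = (a k)%:C.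
Proof. by rewrite /a RRe_real// ger0_real//; case/andP: (overlap_bounds k). Qed.

Let a_bounds k : 0 <= a k <= 1.
Proof.
have := overlap_bounds k.
by rewrite a_real -(rmorph0 (real_complex R)) -(rmorph1 (real_complex R)) !lecR.
Qed.

Let n_gt0 : (0 < n)%N.
Proof.
(* With the default [0^-1 = 0], an empty design would make the left side of the moment identity 0,
   while its right side is nonzero. *)
rewrite lt0n; apply/eqP => n0; have ninv : n%:R^-1 = 0 :> C by rewrite n0 invr0.
have /eqP := design_moments phi 1%:M.
rewrite ninv mul0r pure_trace mxtrace1 mul1r mulmx1 pure_trace.
rewrite eq_sym mulf_eq0 invr_eq0 mulf_eq0 natr1 !pnatr_eq0.
by rewrite -(negbK (d == _)) -lt0n pure_dim_gt0.
Qed.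

Let d_neq0 : d%:R != 0 :> C.
Proof. by rewrite pnatr_eq0 -lt0n pure_dim_gt0. Qed.

Let d1_neq0 : d%:R + 1 != 0 :> C.
Proof. by rewrite natr1 pnatr_eq0. Qed.

Let n_neq0 : n%:R != 0 :> C.
Proof. by rewrite pnatr_eq0 -lt0n. Qed.

Let sum_a : \sum_k a k = n%:R / d%:R.
Proof.
apply: (@complexI R); rewrite rmorph_sum fmorph_div !rmorph_nat /=.
(* The factor [\tr (P k) = 1] is inserted to read the first moment as a second one. *)
rewrite (eq_bigr (fun k => \tr (phi *m P k) * \tr (1%:M *m P k))) => [|k _].
  rewrite -[LHS](mulVKf n_neq0) design_moments mulmx1 pure_trace mxtrace1.
  by field; apply/andP.
by rewrite mul1mx projector_trace mulr1 a_real.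
Qed.

Let sum_a2 : \sum_k a k ^+ 2 = 2 * n%:R / (d%:R * (d%:R + 1)).
Proof.
apply: (@complexI R).
rewrite rmorph_sum fmorph_div !rmorphM rmorphD rmorph1 !rmorph_nat /=.
rewrite (eq_bigr (fun k => \tr (phi *m P k) * \tr (phi *m P k))) => [|k _].
  rewrite -[LHS](mulVKf n_neq0) design_moments pure_idempotent pure_trace.
  by field; apply/andP.
by rewrite a_real -rmorphM.
Qed.

Lemma outcome_ge0 k : 0 <= outcome P phi 0 k.
Proof. by rewrite mxE mulr_ge0 ?divr_ge0//; case/andP: (a_bounds k). Qed.

Lemma outcome_sum1 : \sum_k outcome P phi 0 k = 1.
Proof.
have d0 : d%:R != 0 :> R by rewrite pnatr_eq0 -lt0n pure_dim_gt0.
have n0 : n%:R != 0 :> R by rewrite pnatr_eq0 -lt0n.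
under eq_bigr do rewrite mxE; rewrite -mulr_sumr [X in _ * X]sum_a.
by field; apply/andP.
Qed.

Lemma l1norm_outcome_ge : (1 < d)%N ->
  (d%:R + 1)^-1 <= l1norm (outcome P (phi - max_mixed d)).
Proof.
move=> d1.
have D1 : 1 < d%:R :> R by rewrite ltr1n.
have d0 : d%:R != 0 :> R by rewrite gt_eqF// (lt_trans ltr01).
have n0 : 0 < n%:R :> R by rewrite ltr0n.
have dp : 0 < d%:R :> R by rewrite (lt_trans ltr01).
rewrite outcomeB outcome_max_mixed ?pure_dim_gt0//.
pose y k := a k - d%:R^-1.
have ub k : y k ^+ 2 <= (1 - d%:R^-1) * `|y k|.
  rewrite -real_normK ?num_real// expr2 ler_wpM2r// ler_norml.
  have /andP[a0 a1] := a_bounds k.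
  (* This is where [d >= 2] enters: at [a k = 0] the deviation is [1/d], which must not exceed
     [1 - 1/d]. *)
  have : 2 * d%:R^-1 <= 1 :> R by rewrite ler_pdivrMr// mul1r ler_nat.
  by rewrite /y; move=> ?; apply/andP; split; lra.
have sumy2 : \sum_k y k ^+ 2 = n%:R * (d%:R - 1) / (d%:R ^+ 2 * (d%:R + 1)).
  under eq_bigr do rewrite /y sqrrB.
  rewrite big_split sumrB /= sum_a2 sumrMnl -mulr_suml sum_a sumr_const card_ord.
  rewrite -[_ ^+ 2 *+ n]mulr_natr; field.
  by rewrite d0 gt_eqF ?addr_gt0.
have l1E : l1norm (outcome P phi - const_mx n%:R^-1) = d%:R / n%:R * \sum_k `|y k|.
  rewrite /l1norm mulr_sumr; apply: eq_bigr => k _; rewrite !mxE -/(a k).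
  rewrite -[X in X * `|_|]ger0_norm ?divr_ge0// -normrM; congr `|_|.
  by rewrite /y; field; rewrite d0 gt_eqF.
have : \sum_k y k ^+ 2 <= (1 - d%:R^-1) * \sum_k `|y k|.
  by rewrite mulr_sumr; apply: ler_sum.
rewrite sumy2 l1E => le.
have c0 : 0 < 1 - d%:R^-1 :> R by rewrite subr_gt0 invf_lt1.
(* The variance sum divided by [1 - 1/d] is [n / (d (d + 1))]; the factor [d / n] turns it into
   [1 / (d + 1)]. *)
rewrite -(ler_pM2l c0) mulrCA -(@ler_pM2l _ (n%:R / d%:R)) ?divr_gt0//.
rewrite [X in _ <= X]mulrA (_ : n%:R / d%:R * (d%:R / n%:R) = 1 :> R) ?mul1r.
  apply: le_trans le; rewrite le_eqVlt; apply/orP; left; apply/eqP; field.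
  by rewrite d0 gt_eqF ?addr_gt0.
by field; rewrite d0 gt_eqF.
Qed.

End Pure.
End Design.

(** Comparing the last two constants amounts to [1 - 1/d >= 2/3], that is [d >= 3]. For [d = 2] the
    final bound still holds, directly from the l1-norm; for [d = 1] it fails, since [phi] is then
    maximally mixed. *)
Theorem mainTheorem7 (R : realType) (d n : nat) (P : 'I_n -> 'M[R[i]]_d)
    (designP : proper_spherical_2design P)
    (phi : 'M[R[i]]_d) (pure_phi : pure_state phi) :
  log2 (n%:R : R) - renyi2 (outcome P phi)
    >= log2 n%:R - shannon (outcome P phi)
  /\ log2 n%:R - shannon (outcome P phi)
    = relative_entropy (outcome P phi) (outcome P (max_mixed d))
  /\ relative_entropy (outcome P phi) (outcome P (max_mixed d))
    >= 1 / (2 * ln 2) * l1norm (outcome P (phi - max_mixed d)) ^+ 2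
  /\ 1 / (2 * ln 2) * l1norm (outcome P (phi - max_mixed d)) ^+ 2
    >= 1 / (4 * ln 2) * ((d%:R - 1) / (d%:R * (d%:R + 1) ^+ 2))
  /\ ((3 <= d)%N ->
      1 / (4 * ln 2) * ((d%:R - 1) / (d%:R * (d%:R + 1) ^+ 2))
      >= 1 / (6 * ln 2) * (1 / (d%:R + 1) ^+ 2) :> R)
  /\ ((2 <= d)%N ->
      1 / (2 * ln 2) * l1norm (outcome P (phi - max_mixed d)) ^+ 2
      >= 1 / (6 * ln 2) * (1 / (d%:R + 1) ^+ 2)).
Proof.
have d0 := pure_dim_gt0 pure_phi.
have p0 := outcome_ge0 designP pure_phi.
have p1 := outcome_sum1 designP pure_phi.
have l1ge := l1norm_outcome_ge designP pure_phi.
have maxE := outcome_max_mixed designP d0.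
have ln20 := ln2_gt0 R.
have dp : 0 < d%:R :> R by rewrite ltr0n.
have d1p : 0 < d%:R + 1 :> R by rewrite addr_gt0.
have ln2n : ln 2 != 0 :> R by rewrite gt_eqF.
have dn : d%:R != 0 :> R by rewrite gt_eqF.
have d1n : d%:R + 1 != 0 :> R by rewrite gt_eqF.
set l := l1norm _ in l1ge *.
(* In units of [s] the lower bounds become linear: [1/2], [(1 - 1/d) / 4] and [1/6]. *)
pose s : R := (d%:R + 1) ^- 2 / ln 2.
have s0 : 0 < s by rewrite divr_gt0// invr_gt0 exprn_gt0.
have l2ge : (1 < d)%N -> s <= l ^+ 2 / ln 2.
  move=> /l1ge dl; have dV0 : 0 <= (d%:R + 1)^-1 :> R by rewrite invr_ge0 ltW.
  by rewrite /s -exprVn ler_pM2r ?invr_gt0// ler_pXn2r// nnegrE (le_trans dV0).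
have E1 : 1 / (2 * ln 2) * l ^+ 2 = 2^-1 * (l ^+ 2 / ln 2) by field.
have E2 : 1 / (4 * ln 2) * ((d%:R - 1) / (d%:R * (d%:R + 1) ^+ 2))
    = 4^-1 * (1 - d%:R^-1) * s by rewrite /s; field; rewrite ?dn ?ln2n ?d1n.
have E3 : 1 / (6 * ln 2) * (1 / (d%:R + 1) ^+ 2) = 6^-1 * s.
  by rewrite /s; field; rewrite ?d1n ?ln2n.
split; first by rewrite lerD2l lerN2 renyi2_le_shannon.
split; first by rewrite maxE relative_entropy_uniform.
split; first by rewrite /l outcomeB maxE pinsker_uniform.
rewrite E1 E2 E3.
have dV : 0 < d%:R^-1 :> R by rewrite invr_gt0.
split; last split.
- have [d1|] := ltnP 1 d.
    have := l2ge d1; have := mulr_gt0 dV s0; lra.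
  (* For [d = 1] the factor [1 - 1/d] vanishes, leaving the nonnegativity of a square. *)
  rewrite leq_eqVlt ltnS leqNgt d0 orbF => /eqP ->.
  by rewrite invr1 subrr mulr0 mul0r mulr_ge0 ?divr_ge0 ?invr_ge0 ?sqr_ge0// ltW.
(* Equality occurs at [d = 3]: [(1 - 1/3) / 4 = 1/6]. *)
- move=> d3; have : d%:R^-1 <= 3^-1 :> R by rewrite lef_pV2 ?posrE// ler_nat.
  by rewrite -(ler_pM2r s0); lra.
- by move=> /l2ge; lra.
Qed.
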